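(* The representation of the twisted trigonometric Shibukawa-Ueno operator $\mathcal{R}^t_{\alpha,\beta}$ on $V^t_n\otimes V^t_n$ (with period parameter $\tau_1$) degenerates as $\tau_1\to\infty$ into the representation of the twisted rational Shibukawa-Ueno operator $\mathcal{R}^r_{\alpha,\beta}$ on $V^r_n\otimes V^r_n$. This yields a degeneration of the twisted affinized Cremmer-Gervais matrix $R_{CG(\alpha,\beta)}$ into the twisted affinized Jordan-Cremmer-Gervais matrix $R_{JCG(\alpha,\beta)}$ given by $$\lim_{\tau_1\to\infty}(H\otimes H)^{-1}R_{CG(\alpha,\beta)}(\lambda)(H\otimes H)=R_{JCG(\alpha,\beta)}(\lambda),$$ where $H$ is the $n\times n$ matrix defined by $$H_{ab}=\left(\frac{\tau_1}{2\pi i}\right)^b(-1)^{b-a}\binom{b}{a},\qquad a,b=0,\dots,n-1.$$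
   Context: Here $n$ is a positive integer, $\alpha,\beta\in\mathbb{C}$, and $\kappa$ is a fixed nonzero scalar. For a function $\theta$ put $G_\theta(z,\lambda)=\frac{\theta'(0)\theta(z+\lambda)}{\theta(z)\theta(\lambda)}$ and let $\mathcal{R}^\theta_{\alpha,\beta}(\lambda)$ act on meromorphic functions $f$ on $\mathbb{C}^2$ by $$\mathcal{R}^\theta_{\alpha,\beta}(\lambda)\cdot f(z_1,z_2)=G_\theta(z_1-z_2-2(\alpha\lambda+\beta),\lambda)f(z_2+2\alpha\lambda,z_1-2\alpha\lambda)-G_\theta(z_1-z_2-2(\alpha\lambda+\beta),\kappa)f(z_1-2\beta,z_2+2\beta).$$ $\mathcal{R}^t_{\alpha,\beta}(\lambda)$ is the case $\theta(z)=\sin(\pi z/\tau_1)$, $\tau_1\in\mathbb{C}\setminus\{0\}$, and $\mathcal{R}^r_{\alpha,\beta}(\lambda)$ is the case $\theta(z)=z$; one has $\mathcal{R}^r_{\alpha,\beta}(\lambda)=\lim_{\tau_1\to\infty}\mathcal{R}^t_{\alpha,\beta}(\lambda)$. $V^t_n=V^t_n(\tau_1)=\mathrm{Span}\{\phi_k\mid k=0,\dots,n-1\}$ with $\phi_k(z)=e^{2\pi i(k-\frac{n-1}{2})z/\tau_1}$, and $V^r_n=\mathrm{Span}\{z^k\mid k=0,\dots,n-1\}$. For $V=V^t_n$ or $V^r_n$, $V\otimes V$ is identified with the span of the products $f(z_1)g(z_2)$, $f,g\in V$; these spaces are invariant under $\mathcal{R}^t_{\alpha,\beta}(\lambda)$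 and $\mathcal{R}^r_{\alpha,\beta}(\lambda)$ respectively, and the representations are the restrictions. The basis $\tilde\phi_k=\sum_{l=0}^k(-1)^{k-l}\left(\frac{\tau_1}{2\pi i}\right)^k\binom{k}{l}\phi_l$ of $V^t_n$ satisfies $\lim_{\tau_1\to\infty}\tilde\phi_k(z)=z^k$. Matrices act on $\mathbb{C}^n\otimes\mathbb{C}^n$, with basis vectors indexed by $0,\dots,n-1$, by $R(e_i\otimes e_j)=\sum_{k,l}R_{ij}^{kl}e_k\otimes e_l$, and $He_b=\sum_aH_{ab}e_a$. $R_{CG(\alpha,\beta)}(\lambda)$ has coefficients $R_{CG(\alpha,\beta)}(\lambda)_{ij}^{kl}=\zeta^{2(i-k)}\gamma^{2(j-k)}R_{CG}(\lambda)_{ij}^{kl}$, where $$R_{CG}(\lambda)_{ij}^{kl}=p^{2(j-k)}\begin{cases}q\eta^{-1}-q^{-1}\eta & i=j=k=l,\\ -\hat\eta\, q^{\mathrm{sgn}(i-j)} & i=k\ne l=j,\\ \mathrm{sgn}(j-i)\,\hat\eta\,\hat q & \min(i,j)<k<\max(i,j),\ i+j=k+l,\\ \hat q\,\eta^{\mathrm{sgn}(j-i)} & j=k\neq l=i,\\ 0&\text{otherwise,}\end{cases}$$ with $\hat x=x-x^{-1}$, and, for period parameter $\tau_1$, $q=e^{\pi i\kappa/\tau_1}$, $p=e^{\pi i\kappa/(n\tau_1)}$ (so $p^n=q$), $\eta=e^{\pi i\lambda/\tau_1}$, $\zeta=e^{2\pi i\alpha\lambda/\tau_1}$, $\gamma=e^{2\pi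 i\beta/\tau_1}$. $R_{JCG(\alpha,\beta)}(\lambda)$ is the restriction of $\mathcal{R}^r_{\alpha,\beta}(\lambda)$ to $V^r_n\otimes V^r_n$, written as a matrix in the basis $\{z_1^az_2^b\}$.
   Formalization: The displayed limit is false as written; what is proved has R_CG(α,β) replaced by R_CG(α,β−κ/(2n)) and multiplied by the scalar 2πi/(τ1·q̂·η̂), with limit R_JCG(α,β); λ≠0 is assumed so that the operators are defined. *)

(* Defs.v *)
From HB Require Import structures.
From mathcomp Require Import all_boot all_order all_algebra.
From mathcomp Require Import all_classical all_reals all_analysis.
From mathcomp Require Import complex mxtens.

Set Implicit Arguments.
Unset Strict Implicit.
Unset Printing Implicit Defensive.

Import Order.TTheory GRing.Theory Num.Theory.
Import numFieldNormedType.Exports.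

Local Open Scope classical_set_scope.
Local Open Scope complex_scope.
Local Open Scope ring_scope.

(* The topology of a numeric field is the norm topology of its regular module;
   it is transferred here to the concrete type R[i]. *)
HB.instance Definition _ (R : rcfType) := NormedModule.copy R[i] R[i]^o.

Definition ipi {R : realType} : R[i] := 0 +i* pi.

Definition cexp {R : realType} (z : R[i]) : R[i] :=
  (expR (complex.Re z) * cos (complex.Im z))
    +i* (expR (complex.Re z) * sin (complex.Im z)).

Definition csin {R : realType} (z : R[i]) : R[i] :=
  (cexp ('i * z) - cexp (- ('i * z))) / (2 * 'i).

(* Neighbourhoods of the point at infinity of the Riemann sphere: the
   direction in which t goes to infinity is unrestricted. *)
Definition cinfty {R : realType} : set_system R[i] :=
  [set P | exists M : R, forall t : R[i], M%:C < `|t| -> P t].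

#[global] Instance cinfty_filter (R : realType) : ProperFilter (@cinfty R).
Proof.
split; first by case=> M /(_ (`|M| + 1)%:C); apply; rewrite normc_def /= expr0n
  addr0 sqrtr_sqr ltcR ger0_norm ?addr_ge0// ltr_pwDr// ler_norm.
split; first by exists 0.
- move=> P Q [M HM] [N HN]; exists (Num.max M N) => t; rewrite normc_def ltcR.
  by rewrite gt_max => /andP[h1 h2]; split; [apply: HM|apply: HN];
    rewrite normc_def ltcR.
- by move=> P Q PQ [M HM]; exists M => t /HM /PQ.
Qed.

(* Meromorphic functions on C^2 are represented by total functions, whose values
   on the polar set are irrelevant; two of them are the same meromorphic
   function when they agree on a dense open set. *)
Definition mero_eq {R : realType} (f g : R[i] -> R[i] -> R[i]) : Prop :=
  exists U : set (R[i] * R[i]),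
    [/\ open U, dense U & forall z, U z -> f z.1 z.2 = g z.1 z.2].

Definition Gth {R : realType} (theta : R[i] -> R[i]) (z lam : R[i]) : R[i] :=
  derive1 theta 0 * theta (z + lam) / (theta z * theta lam).

Definition SU {R : realType} (theta : R[i] -> R[i]) (kappa alpha beta lam : R[i])
    (f : R[i] -> R[i] -> R[i]) : R[i] -> R[i] -> R[i] :=
  fun z1 z2 =>
    Gth theta (z1 - z2 - 2 * (alpha * lam + beta)) lam
      * f (z2 + 2 * alpha * lam) (z1 - 2 * alpha * lam)
    - Gth theta (z1 - z2 - 2 * (alpha * lam + beta)) kappa
      * f (z1 - 2 * beta) (z2 + 2 * beta).

Definition SUt {R : realType} (tau kappa alpha beta lam : R[i]) :=
  SU (fun z : R[i] => csin (pi%:C * z / tau)) kappa alpha beta lam.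

Definition SUr {R : realType} (kappa alpha beta lam : R[i]) :=
  SU (fun z : R[i] => z) kappa alpha beta lam.

Definition fspan {R : realType} n (b : 'I_n -> R[i] -> R[i])
    : set (R[i] -> R[i]) :=
  [set f | exists c : 'I_n -> R[i], forall z, f z = \sum_k c k * b k z].

Definition is_basis {R : realType} n (V : set (R[i] -> R[i]))
    (b : 'I_n -> R[i] -> R[i]) : Prop :=
  V = fspan b /\
  forall c : 'I_n -> R[i], (forall z, \sum_k c k * b k z = 0) ->
    forall k, c k = 0.

Definition tens {R : realType} (f g : R[i] -> R[i]) : R[i] -> R[i] -> R[i] :=
  fun z1 z2 => f z1 * g z2.

(* For a linear subspace V, sums of products already form a linear space. *)
Definition tens_sq {R : realType} (V : set (R[i] -> R[i]))
    : set (R[i] -> R[i] -> R[i]) :=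
  [set F | exists m (f g : 'I_m -> R[i] -> R[i]),
    (forall i, V (f i) /\ V (g i)) /\
    forall z1 z2, F z1 z2 = \sum_i tens (f i) (g i) z1 z2].

Definition invariant_under {R : realType}
    (Op : (R[i] -> R[i] -> R[i]) -> (R[i] -> R[i] -> R[i]))
    (W : set (R[i] -> R[i] -> R[i])) : Prop :=
  forall F, W F -> exists2 G, W G & mero_eq (Op F) G.

(* Column convention: column (i, j) holds the coordinates of the image of
   b_i (x) b_j, as in R (e_i (x) e_j) = sum R_ij^kl e_k (x) e_l. *)
Definition represents {R : realType} n
    (Op : (R[i] -> R[i] -> R[i]) -> (R[i] -> R[i] -> R[i]))
    (b : 'I_n -> R[i] -> R[i]) (M : 'M[R[i]]_(n * n)) : Prop :=
  forall i j : 'I_n,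
    mero_eq (Op (tens (b i) (b j)))
      (fun z1 z2 => \sum_k \sum_l
         M (mxtens_index (k, l)) (mxtens_index (i, j)) * tens (b k) (b l) z1 z2).

(* The matrix of the restriction of Op to V (x) V in the basis b_i (x) b_j; it
   exists and is unique if b is a basis of V, its elements are continuous and
   Op leaves V (x) V invariant. *)
Definition rep_mx {R : realType} n
    (Op : (R[i] -> R[i] -> R[i]) -> (R[i] -> R[i] -> R[i]))
    (b : 'I_n -> R[i] -> R[i]) : 'M[R[i]]_(n * n) :=
  xget 0 [set M | represents Op b M].

Definition phi {R : realType} n (tau : R[i]) (k : 'I_n) (z : R[i]) : R[i] :=
  cexp (2 * ipi * (k%:R - (n%:R - 1) / 2) * z / tau).

Definition Vt {R : realType} n (tau : R[i]) : set (R[i] -> R[i]) :=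
  fspan (phi (n := n) tau).

Definition mono {R : realType} n (k : 'I_n) (z : R[i]) : R[i] := z ^+ k.

Definition Vr {R : realType} n : set (R[i] -> R[i]) := fspan (@mono R n).

(* The terms with l > k vanish since then 'C(k, l) = 0. *)
Definition phit {R : realType} n (tau : R[i]) (k : 'I_n) (z : R[i]) : R[i] :=
  \sum_(l < n) (-1) ^ (k%:Z - l%:Z) * (tau / (2 * ipi)) ^+ k * 'C(k, l)%:R
    * phi tau l z.

(* Op t, acting on V t (x) V t, degenerates into Op0, acting on V0 (x) V0: in
   bases b t of V t that converge to a basis b0 of V0, the matrices converge. *)
Definition rep_degenerates {R : realType} n
    (Op : R[i] -> (R[i] -> R[i] -> R[i]) -> (R[i] -> R[i] -> R[i]))
    (V : R[i] -> set (R[i] -> R[i])) (b : R[i] -> 'I_n -> R[i] -> R[i])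
    (Op0 : (R[i] -> R[i] -> R[i]) -> (R[i] -> R[i] -> R[i]))
    (V0 : set (R[i] -> R[i])) (b0 : 'I_n -> R[i] -> R[i]) : Prop :=
  [/\ \forall t \near cinfty,
        is_basis (V t) (b t) /\ invariant_under (Op t) (tens_sq (V t)),
      is_basis V0 b0 /\ invariant_under Op0 (tens_sq V0),
      forall k z, b t k z @[t --> cinfty] --> b0 k z
    & rep_mx (Op t) (b t) @[t --> cinfty] --> rep_mx Op0 b0].

Definition qCG {R : realType} (tau kappa : R[i]) : R[i] := cexp (ipi * kappa / tau).
Definition pCG {R : realType} n (tau kappa : R[i]) : R[i] :=
  cexp (ipi * kappa / (n%:R * tau)).
Definition etaCG {R : realType} (tau lam : R[i]) : R[i] := cexp (ipi * lam / tau).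
Definition zetaCG {R : realType} (tau alpha lam : R[i]) : R[i] :=
  cexp (2 * ipi * alpha * lam / tau).
Definition gammaCG {R : realType} (tau beta : R[i]) : R[i] :=
  cexp (2 * ipi * beta / tau).

Definition hatc {R : realType} (x : R[i]) : R[i] := x - x^-1.

Definition CG_coef {R : realType} n (tau kappa lam : R[i]) (i j k l : 'I_n)
    : R[i] :=
  let q := qCG tau kappa in
  let p := pCG n tau kappa in
  let eta := etaCG tau lam in
  p ^ (2 * (j%:Z - k%:Z)) *
  (if [&& i == j, j == k & k == l] then q * eta^-1 - q^-1 * eta
   else if [&& i == k, k != l & l == j] then
     - hatc eta * q ^ sgz (i%:Z - j%:Z)
   else if (minn i j < k < maxn i j)%N && (i + j == k + l)%N then
     (sgz (j%:Z - i%:Z))%:~R * hatc eta * hatc q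
   else if [&& j == k, k != l & l == i] then
     hatc q * eta ^ sgz (j%:Z - i%:Z)
   else 0).

Definition tCG_coef {R : realType} n (tau kappa alpha beta lam : R[i])
    (i j k l : 'I_n) : R[i] :=
  zetaCG tau alpha lam ^ (2 * (i%:Z - k%:Z))
  * gammaCG tau beta ^ (2 * (j%:Z - k%:Z))
  * CG_coef tau kappa lam i j k l.

Definition R_CG {R : realType} n (tau kappa alpha beta lam : R[i])
    : 'M[R[i]]_(n * n) :=
  \matrix_(kl, ij)
    tCG_coef tau kappa alpha beta lam
      (mxtens_unindex ij).1 (mxtens_unindex ij).2
      (mxtens_unindex kl).1 (mxtens_unindex kl).2.

Definition R_JCG {R : realType} n (kappa alpha beta lam : R[i])
    : 'M[R[i]]_(n * n) :=
  rep_mx (SUr kappa alpha beta lam) (@mono R n).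

Definition Hmx {R : realType} n (tau : R[i]) : 'M[R[i]]_n :=
  \matrix_(a, b)
    ((tau / (2 * ipi)) ^+ b * (-1) ^ (b%:Z - a%:Z) * 'C(b, a)%:R).

(* R_CG is a non-normalised R-matrix: with this factor it becomes the matrix, in
   the basis phi_i (x) phi_j, of the operator SUt with the same kappa, alpha,
   lam and with beta + kappa / (2 n) in place of beta; the shift of beta is the
   effect of the factor p ^ (2 (j - k)), which is absent from SUt. *)
Definition CG_norm {R : realType} (tau kappa lam : R[i]) : R[i] :=
  2 * ipi / (tau * hatc (qCG tau kappa) * hatc (etaCG tau lam)).

(* Main.v *)
Require Import Defs.
From HB Require Import structures.
From mathcomp Require Import all_boot all_order all_algebra.
From mathcomp Require Import all_classical all_reals all_analysis.
From mathcomp Require Import complex mxtens.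
From mathcomp Require Import ring lra zify.

(** Put [e_t(z) = exp(2 pi i z / t)] and [d_t(z) = (t / 2 pi i) (e_t(z) - 1)],
    so that [d_t(z) --> z] as [t --> oo].  Both the kernel
    [G(z, w) = d_t(z + w) / (d_t(z) d_t(w))] of the trigonometric operator and
    the basis [phit_k(z) = e_t(- (n - 1) z / 2) d_t(z)^k] are expressed through
    [d_t], hence converge pointwise to their rational counterparts.

    Setting [P = e_t(z1 - 2 beta)] and [Q = e_t(z2 + 2 alpha lam)], the action
    of the trigonometric operator on [phi_i (x) phi_j] is a telescoping sum in
    monomials [P^k Q^l] with [k + l = i + j], which gives the normalised
    Cremmer-Gervais matrix; passing from [phi] to [phit] conjugates it by
    [H (x) H].

    Evaluating on a grid of points [(x_a, y_b)] off the poles turns the matrix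
    [M_t] of the operator into [B_t^-1 F_t], where [B_t] holds the values of the
    basis and [F_t] those of its image.  As [B_0] is a tensor product of
    Vandermonde matrices, [M_t] converges to [B_0^-1 F_0]; by uniqueness of
    pointwise limits this limit represents the rational operator, so neither its
    matrix nor the invariance of the polynomial space has to be computed. *)

Import Order.TTheory GRing.Theory Num.Theory.
Import numFieldNormedType.Exports.

Local Open Scope classical_set_scope.
Local Open Scope complex_scope.
Local Open Scope ring_scope.

Set Implicit Arguments.
Unset Strict Implicit.
Unset Printing Implicit Defensive.

(** * Limits of complex functions and matrices *)

(** A neighbourhood of [A] contains a product of neighbourhoods of its entries, and the filter is
    stable under finite intersections. *)
Lemma cvg_mx (T : topologicalType) (I : Type) (F : set_system I) {FF : Filter F}
    m n (f : I -> 'M[T]_(m, n)) (A : 'M[T]_(m, n)) :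
  (forall i j, f x i j @[x --> F] --> A i j) -> f x @[x --> F] --> A.
Proof.
move=> fA B [P AP PB].
apply: (@filterS _ F _ [set x | forall i j, P i j (f x i j)]).
  by move=> x Px; apply: PB.
by apply: filter_forall => i; apply: filter_forall => j; exact: fA (AP i j).
Qed.

(* Instances of the general limit lemmas: at the concrete type [R[i]] the latter
   unify in reasonable time only when all their arguments are given. *)
Section complex_limits.
Context {R : realType} {I : Type} {F : set_system I} {FF : ProperFilter F}.
Implicit Types (f g : I -> R[i]) (l m : R[i]).

Lemma ccvg_dist f l :
  (forall e : R[i], 0 < e -> \forall x \near F, `|l - f x| < e) <->
  f x @[x --> F] --> l.
Proof. by symmetry; exact: (@cvgrPdist_lt R[i] R[i]^o I F _ f l). Qed.

Lemma ccvgD f g l m : f x @[x --> F] --> l -> g x @[x --> F] --> m ->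
  f x + g x @[x --> F] --> l + m.
Proof. exact: (@cvgD R[i] R[i]^o I F _ f g l m). Qed.

Lemma ccvgB f g l m : f x @[x --> F] --> l -> g x @[x --> F] --> m ->
  f x - g x @[x --> F] --> l - m.
Proof. exact: (@cvgB R[i] R[i]^o I F _ f g l m). Qed.

Lemma ccvgM f g l m : f x @[x --> F] --> l -> g x @[x --> F] --> m ->
  f x * g x @[x --> F] --> l * m.
Proof. exact: (@cvgM R[i] I F _ f g l m). Qed.

Lemma ccvgV f l : l != 0 -> f x @[x --> F] --> l ->
  (f x)^-1 @[x --> F] --> l^-1.
Proof. exact: (@cvgV R[i] I F _ f l). Qed.

Lemma ccvg_unique f l m :
  f x @[x --> F] --> l -> f x @[x --> F] --> m -> l = m.
Proof.
exact: (@cvg_unique _ (@norm_hausdorff R[i] R[i]^o) (f @ F) _ l m).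
Qed.

Lemma ccvg_lim f l : f x @[x --> F] --> l -> lim (f x @[x --> F]) = l.
Proof.
exact: (@cvg_lim _ (@norm_hausdorff R[i] R[i]^o) I F _ f l).
Qed.

Lemma ccvg_neq0 f l : f x @[x --> F] --> l -> l != 0 ->
  \forall x \near F, f x != 0.
Proof. exact: (@cvgr_neq0 R[i] R[i]^o I F _ f l). Qed.

Lemma ccvg_near_eq f g l : (\forall x \near F, f x = g x) ->
  f x @[x --> F] --> l -> g x @[x --> F] --> l.
Proof.
move=> fg fl; apply: cvg_trans fl; apply: near_eq_cvg.
by apply: filterS fg.
Qed.

Lemma ccvg_sum (J : Type) (r : seq J) (P : pred J) (h : J -> I -> R[i])
    (l : J -> R[i]) : (forall k, h k x @[x --> F] --> l k) ->
  \sum_(k <- r | P k) h k x @[x --> F] --> \sum_(k <- r | P k) l k.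
Proof.
move=> hl; elim: r => [|k r IH].
  by under eq_fun do rewrite big_nil; rewrite big_nil; exact: cvg_cst.
under eq_fun do rewrite big_cons; rewrite big_cons.
case: (P k); last exact: IH.
exact: (ccvgD (hl k) IH).
Qed.

Lemma ccvg_prod (J : Type) (r : seq J) (P : pred J) (h : J -> I -> R[i])
    (l : J -> R[i]) : (forall k, h k x @[x --> F] --> l k) ->
  \prod_(k <- r | P k) h k x @[x --> F] --> \prod_(k <- r | P k) l k.
Proof.
move=> hl; elim: r => [|k r IH].
  by under eq_fun do rewrite big_nil; rewrite big_nil; exact: cvg_cst.
under eq_fun do rewrite big_cons; rewrite big_cons.
case: (P k); last exact: IH.
exact: (ccvgM (hl k) IH).
Qed.

Lemma ccvgX f l k : f x @[x --> F] --> l -> f x ^+ k @[x --> F] --> l ^+ k.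
Proof.
move=> fl; elim: k => [|k IH].
  by under eq_fun do rewrite expr0; rewrite expr0; exact: cvg_cst.
by under eq_fun do rewrite exprS; rewrite exprS; exact: ccvgM.
Qed.

Lemma ccvg_det n (f : I -> 'M[R[i]]_n) (A : 'M[R[i]]_n) :
  (forall i j, f x i j @[x --> F] --> A i j) ->
  \det (f x) @[x --> F] --> \det A.
Proof.
move=> fA; apply: ccvg_sum => s; apply: ccvgM; first exact: cvg_cst.
by apply: ccvg_prod => i; exact: fA.
Qed.

Lemma ccvg_mulmx (m n p : nat) (f : I -> 'M[R[i]]_(m, n))
    (g : I -> 'M[R[i]]_(n, p)) (A : 'M[R[i]]_(m, n)) (B : 'M[R[i]]_(n, p)) :
  (forall i j, f x i j @[x --> F] --> A i j) ->
  (forall i j, g x i j @[x --> F] --> B i j) ->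
  forall i j, (f x *m g x) i j @[x --> F] --> (A *m B) i j.
Proof.
move=> fA gB i j; under eq_fun do rewrite mxE; rewrite mxE.
by apply: ccvg_sum => k; exact: ccvgM.
Qed.

Lemma ccvg_unitmx n (f : I -> 'M[R[i]]_n) (A : 'M[R[i]]_n) :
  (forall i j, f x i j @[x --> F] --> A i j) -> A \in unitmx ->
  \forall x \near F, f x \in unitmx.
Proof.
move=> fA; rewrite unitmxE unitfE => A0.
have := ccvg_neq0 (ccvg_det fA) A0.
by apply: filterS => x; rewrite unitmxE unitfE.
Qed.

Lemma ccvg_invmx n (f : I -> 'M[R[i]]_n) (A : 'M[R[i]]_n) :
  (forall i j, f x i j @[x --> F] --> A i j) -> A \in unitmx ->
  forall i j, invmx (f x) i j @[x --> F] --> invmx A i j.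
Proof.
move=> fA Au i j.
(* [invmx] is the adjugate divided by the determinant only at invertible matrices and returns its
   argument elsewhere, hence the restriction to [x] with [f x] invertible. *)
apply: (@ccvg_near_eq (fun x => (\det (f x))^-1 * cofactor (f x) j i)).
  have := ccvg_unitmx fA Au.
  by apply: filterS => x fu; rewrite /invmx fu !mxE.
rewrite /invmx Au !mxE; apply: ccvgM.
  apply: ccvgV; last exact: ccvg_det.
  by move: Au; rewrite unitmxE unitfE.
apply: ccvgM; first exact: cvg_cst.
apply: ccvg_det => k l; rewrite !mxE.
by under eq_fun do rewrite !mxE; exact: fA.
Qed.

End complex_limits.

(** * The complex exponential *)

(** Multiplying the estimate of the difference quotient by $|x|$ gives a first-order expansion that
    also covers $x = 0$. *)
Lemma derive_near0 (R : realType) (f : R -> R) (df : R) :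
  is_derive (0 : R) (1 : R) f df ->
  forall e : R, 0 < e -> exists2 d : R, 0 < d &
    forall x, `|x| < d -> `|f x - f 0 - df * x| <= e * `|x|.
Proof.
case=> cvf dfE e e0; have := cvf.
rewrite /derivable /= => /cvgP /=.
rewrite -/(derive f 0 1) dfE.
move=> /cvgrPdist_le/(_ e e0).
rewrite near_withinE => -[d /= d0 dP]; exists d => // x xd.
have [->|x0] := eqVneq x 0; first by rewrite mulr0 !subrr normr0 mulr0.
have := dP x; rewrite /= sub0r normrN => /(_ xd x0).
have nx0 : 0 < `|x| by rewrite normr_gt0.
rewrite addr0 -(ler_pM2r nx0) -normrM mulrBl distrC.
by rewrite (_ : x%:A = x) /GRing.scale /= ?mulr1// mulrAC mulVf// mul1r.
Qed.

Section cexp_theory.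
Context {R : realType}.
Implicit Types (x y : R) (z w h : R[i]).

Lemma normc_le_ReIm z : `|z| <= (`|complex.Re z| + `|complex.Im z|)%:C.
Proof.
rewrite normc_def lecR -(ler_sqr _ _) ?nnegrE ?sqrtr_ge0 ?addr_ge0//.
rewrite sqr_sqrtr ?addr_ge0 ?sqr_ge0// sqrrD !real_normK ?num_real//.
by rewrite addrAC lerDl mulrn_wge0// mulr_ge0.
Qed.

Lemma normc_ge_Im z : `|complex.Im z|%:C <= `|z|.
Proof.
rewrite normc_def lecR -sqrtr_sqr ler_wsqrtr// lerDr sqr_ge0//.
Qed.

Lemma cexpD z w : cexp (z + w) = cexp z * cexp w.
Proof.
case: z w => [a b] [c d]; rewrite /cexp /= expRD cosD sinD.
apply/eqP; rewrite eq_complex /=; apply/andP; split; apply/eqP; ring.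
Qed.

Lemma cexp0 : cexp 0 = 1 :> R[i].
Proof. by rewrite /cexp /= expR0 cos0 sin0 mulr1 mulr0. Qed.

Lemma cexp_neq0 z : cexp z != 0.
Proof.
apply/eqP => z0; have /eqP := cexpD z (- z).
by rewrite subrr cexp0 z0 mul0r oner_eq0.
Qed.

Lemma cexpN z : cexp (- z) = (cexp z)^-1.
Proof.
apply: (mulfI (cexp_neq0 z)).
by rewrite -cexpD subrr cexp0 mulfV ?cexp_neq0.
Qed.

Lemma cexpMn (n : nat) z : cexp (n%:R * z) = cexp z ^+ n.
Proof.
elim: n => [|n IH]; first by rewrite mul0r cexp0.
by rewrite exprS -IH -cexpD -natr1 mulrDl mul1r addrC.
Qed.

Lemma cexpMz (m : int) z : cexp (m%:~R * z) = cexp z ^ m.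
Proof.
case: m => n; first exact: cexpMn.
by rewrite NegzE mulrNz mulNr cexpN -exprnN -cexpMn.
Qed.

(** Differentiability at $0$, taken from the real exponential, cosine and sine; with [cexpD] it
    carries the analysis of [cexp] below. *)
Lemma cexp_near0 (e : R) : 0 < e -> exists2 d : R, 0 < d &
  forall h, `|h| < d%:C -> `|cexp h - 1 - h| <= e%:C * `|h|.
Proof.
move=> e0.
(* The bound $e/8$ leaves room for the error terms [t1] to [t5], which add up to $7 e' n$; the bound
   $1/2$ gives [E <= 2]. *)
have [e' [e'0 e'1 e'e]] : exists e' : R, [/\ 0 < e', e' <= 1 / 2 & e' <= e / 8].
  exists (Num.min (e / 8) (1 / 2)).
  by rewrite lt_min !divr_gt0//; split=> //; rewrite ge_min lexx ?orbT.
have [d1 d10 h1] := derive_near0 (is_derive_expR 0) e'0.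
have [d2 d20 h2] := derive_near0 (is_derive_cos 0) e'0.
have [d3 d30 h3] := derive_near0 (is_derive_sin 0) e'0.
exists (Num.min (Num.min d1 d2) (Num.min d3 e')).
  by rewrite !lt_min d10 d20 d30 e'0.
case=> x y; set n := complex.Re `|x +i* y|.
have nE : `|x +i* y| = n%:C by rewrite /n normc_def.
have xn : `|x| <= n by rewrite -lecR -nE (normc_ge_Re (x +i* y)).
have yn : `|y| <= n by rewrite -lecR -nE (normc_ge_Im (x +i* y)).
rewrite nE ltcR !lt_min => /andP[/andP[nd1 nd2] /andP[nd3 ne']].
have {}h1 := h1 x (le_lt_trans xn nd1).
have {}h2 := h2 y (le_lt_trans yn nd2).
have {}h3 := h3 y (le_lt_trans yn nd3).
apply: le_trans (normc_le_ReIm _) _; rewrite -rmorphM lecR /cexp /=.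
move: h1 h2 h3; rewrite expR0 cos0 sin0 mul1r oppr0 mul0r mul1r !subr0 !addr0.
set E := expR x; set c := cos y; set s := sin y => h1 h2 h3.
(* Both components are expressed through the three real first-order errors; the only other term,
   $xy$, is small because $n < e'$. *)
have -> : E * c - 1 - x = (E - 1 - x) + E * (c - 1) by ring.
have -> : E * s - y = E * (s - y) + (E - 1 - x) * y + x * y by ring.
have E0 : 0 < E := expR_gt0 x.
have n0 : 0 <= n := le_trans (normr_ge0 _) xn.
have E2 : E <= 2.
  have : E - 1 - x <= e' * `|x| := le_trans (ler_norm _) h1.
  have := ler_norm x; nra.
have t1 : `|E - 1 - x| <= e' * n by nra.
have t2 : `|E * (c - 1)| <= 2 * (e' * n).
  by rewrite normrM (gtr0_norm E0) ler_pM ?normr_ge0 ?(ltW E0)//; nra.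
have t3 : `|E * (s - y)| <= 2 * (e' * n).
  by rewrite normrM (gtr0_norm E0) ler_pM ?normr_ge0 ?(ltW E0)//; nra.
have t4 : `|(E - 1 - x) * y| <= e' * n.
  rewrite normrM -[leRHS]mulr1 ler_pM ?normr_ge0//; lra.
have t5 : `|x * y| <= e' * n.
  rewrite normrM ler_pM ?normr_ge0//; lra.
have := ler_normD (E - 1 - x) (E * (c - 1)).
have := ler_normD (E * (s - y) + (E - 1 - x) * y) (x * y).
have := ler_normD (E * (s - y)) ((E - 1 - x) * y).
have : e' * n * 7 <= e * n by rewrite mulrAC ler_wpM2r//; lra.
lra.
Qed.

End cexp_theory.

(** * Limits at the point at infinity *)

Section limits_at_infinity.
Context {R : realType}.
Implicit Types (z w h t e : R[i]).

(** Radii and norms are elements of [R[i]]; this lemma and [normc_real] move estimates to the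
    totally ordered field [R]. *)
Lemma gt0_real e : 0 < e -> exists2 r : R, 0 < r & e = r%:C.
Proof.
case: e => a b; rewrite ltcE /= => /andP[/eqP -> a0].
by exists a.
Qed.

Lemma normc_real z : exists2 r : R, 0 <= r & `|z| = r%:C.
Proof.
rewrite normc_def.
exists (Num.sqrt (complex.Re z ^+ 2 + complex.Im z ^+ 2)); last by [].
exact: sqrtr_ge0.
Qed.

Lemma near_cinfty_neq0 : \forall t \near @cinfty R, t != 0.
Proof.
by exists 0 => t; rewrite normr_gt0.
Qed.

Lemma ipi_neq0 : 2 * ipi != 0 :> R[i].
Proof.
rewrite mulf_neq0 ?pnatr_eq0// eq_complex negb_and /= orbC.
by rewrite gt_eqF ?pi_gt0.
Qed.

Lemma cvg_inv_cinfty : t^-1 @[t --> @cinfty R] --> (0 : R[i]).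
Proof.
apply/ccvg_dist => _ /gt0_real[r r0 ->].
exists r^-1 => t tr; rewrite sub0r normrN normfV invf_plt.
- by rewrite -fmorphV.
- by rewrite posrE (lt_trans _ tr)// ltcR invr_gt0.
- by rewrite posrE ltcR.
Qed.

(** [qexp] and [qnum] are $e_t$ and $d_t$ of the overview: [qnum t z] is $(e^{hz} - 1)/h$ for $h =
    2\pi i/t$, a deformation of $z$. *)
Definition qexp t z : R[i] := cexp (2 * ipi * z / t).

Definition qnum t z : R[i] := t / (2 * ipi) * (qexp t z - 1).

Lemma qexpD t z w : qexp t (z + w) = qexp t z * qexp t w.
Proof. by rewrite /qexp mulrDr mulrDl cexpD. Qed.

Lemma qexpN t z : qexp t (- z) = (qexp t z)^-1.
Proof. by rewrite /qexp mulrN mulNr cexpN. Qed.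

Lemma qexpB t z w : qexp t (z - w) = qexp t z / qexp t w.
Proof. by rewrite qexpD qexpN. Qed.

Lemma qexp_neq0 t z : qexp t z != 0.
Proof. exact: cexp_neq0. Qed.

Lemma qnum_cvg z : qnum t z @[t --> cinfty] --> z.
Proof.
apply/ccvg_dist => _ /gt0_real[r r0 ->].
have [s s0 zs] := normc_real z.
have [M M0 zM] := normc_real (2 * ipi * z).
have s1 : 0 < s + 1 by rewrite ltr_wpDl.
have [d d0 dP] := cexp_near0 (divr_gt0 r0 s1).
(* Beyond [M / d] the argument $2\pi i z/t$ has norm less than [d]; dividing by [s + 1] instead of
   [s] covers $z = 0$. *)
exists (M / d) => t tM.
have t0 : 0 < `|t| by rewrite (le_lt_trans _ tM)// lecR divr_ge0// ltW.
have tn0 : t != 0 by rewrite -normr_gt0.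
have {}dP : `|cexp (2 * ipi * z / t) - 1 - 2 * ipi * z / t| <=
    (r / (s + 1))%:C * `|2 * ipi * z / t|.
  apply: dP; rewrite normrM normfV zM ltr_pdivrMr// -ltr_pdivrMl ?ltcR//.
  by rewrite -fmorphV -rmorphM mulrC.
move: dP; rewrite [X in _ <= _ * X]normrM normfV zM => dP.
move: ipi_neq0 dP zM; rewrite /qnum /qexp.
move: (2 * ipi) => u u0; move: (cexp _) => E dP zM.
have -> : z - t / u * (E - 1) = - (t / u) * (E - 1 - u * z / t).
  by field; rewrite tn0 u0.
rewrite normrM normrN; apply: le_lt_trans (ler_wpM2l (normr_ge0 _) dP) _.
have -> : `|t / u| * ((r / (s + 1))%:C * (M%:C / `|t|)) =
    (r / (s + 1) * s)%:C.
  have : `|u| != 0 by rewrite normr_eq0.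
  have : `|t| != 0 by rewrite normr_eq0.
  rewrite -zM [RHS]rmorphM /= -zs !normrM normfV.
  move: `|u| `|t| `|z| (r / _)%:C => U T Z a T0 U0.
  by field; rewrite T0 U0.
rewrite ltcR mulrAC ltr_pdivrMr// ltr_pM2l//; lra.
Qed.

(** This follows from $e_t(w) = 1 + (2\pi i/t) d_t(w)$ and $d_t(w) \to w$. *)
Lemma cexp_div_cvg z : cexp (z / t) @[t --> cinfty] --> (1 : R[i]).
Proof.
set w := z / (2 * ipi).
have zE : z = 2 * ipi * w by rewrite mulrC divfK ?ipi_neq0.
apply: (@ccvg_near_eq _ _ _ _ (fun t => qnum t w * (2 * ipi * t^-1) + 1)).
  near=> t; rewrite zE /qnum -/(qexp t w).
  have t0 : t != 0 by near: t; exact: near_cinfty_neq0.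
  have u0 := ipi_neq0; set u := 2 * ipi in u0 *.
  by field; rewrite t0 u0.
rewrite -[X in _ --> X]add0r -(mulr0 w) -(mulr0 (2 * ipi)).
apply: ccvgD; last exact: cvg_cst.
apply: ccvgM; first exact: qnum_cvg.
apply: ccvgM; first exact: cvg_cst.
exact: cvg_inv_cinfty.
Unshelve. all: by end_near. Qed.

End limits_at_infinity.

(** * Derivative and continuity of the exponential, and the kernel *)

Section cexp_analysis.
Context {R : realType}.
Implicit Types (z w h t e : R[i]).

Lemma cexp_deriv0 a : (cexp (a * h) - 1) / h @[h --> 0^'] --> (a : R[i]).
Proof.
apply/ccvg_dist => _ /gt0_real[r r0 ->].
have [s s0 zs] := normc_real a.
have s1 : 0 < s + 1 by rewrite ltr_wpDl.
have [d d0 dP] := cexp_near0 (divr_gt0 r0 s1).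
have ds : 0 < (d / (s + 1))%:C by rewrite ltcR divr_gt0.
have := @dnbhs0_lt R[i] R[i]^o _ ds.
have := @nbhs_dnbhs_neq R[i]^o 0.
apply: filterS2 => h h0 hd.
have {}dP : `|cexp (a * h) - 1 - a * h| <= (r / (s + 1))%:C * (s%:C * `|h|).
  rewrite -zs -normrM; apply: dP.
  rewrite normrM zs; apply: (@le_lt_trans _ _ ((s + 1)%:C * `|h|)).
    by rewrite ler_wpM2r// lecR lerDl.
  move: hd; rewrite [(d / _)%:C]rmorphM fmorphV ltr_pdivlMr ?ltcR//.
  by rewrite mulrC.
have -> : a - (cexp (a * h) - 1) / h = - h^-1 * (cexp (a * h) - 1 - a * h).
  by move: (cexp _) => E; field; rewrite h0.
rewrite normrM normrN normfV mulrC ltr_pdivrMr ?normr_gt0//.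
apply: (le_lt_trans dP); rewrite mulrA ltr_pM2r ?normr_gt0//.
by rewrite -rmorphM ltcR mulrAC ltr_pdivrMr// ltr_pM2l//; lra.
Qed.

Lemma cexp_near1 (r : R) : 0 < r -> exists2 d : R, 0 < d &
  forall h, `|h| < d%:C -> `|cexp h - 1| < r%:C.
Proof.
move=> r0; have [d d0 dP] := @cexp_near0 R 1 ltr01.
exists (Num.min d (r / 3)) => [|h]; first by rewrite lt_min d0 divr_gt0.
have [s s0 hs] := normc_real h.
rewrite hs ltcR lt_min => /andP[sd sr].
have := dP h; rewrite hs ltcR => /(_ sd); rewrite -rmorphM mul1r => hP.
rewrite -[_ - 1](subrK h); apply: le_lt_trans (ler_normD _ _) _.
rewrite hs; apply: le_lt_trans (lerD hP (lexx _)) _.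
by rewrite -rmorphD ltcR; lra.
Qed.

Lemma continuous_cexp : continuous (cexp : R[i] -> R[i]).
Proof.
move=> z; apply: (@ccvg_dist _ _ (nbhs (z : R[i])) (nbhs_pfilter _) _ _).1.
move=> _ /gt0_real[r r0 ->].
have [s s0 zs] := normc_real (cexp z).
have s1 : 0 < s + 1 by rewrite ltr_wpDl.
have [d d0 dP] := cexp_near1 (divr_gt0 r0 s1).
apply/nbhs_ballP; exists d%:C => [|w zw]; first by rewrite /= ltcR.
rewrite -[ball _ _ _]/(is_true (`|z - w| < d%:C)) in zw.
change (is_true (`|cexp z - cexp w| < r%:C)).
(* The functional equation reduces continuity at [z] to continuity at $0$. *)
have -> : cexp w = cexp z * cexp (w - z) by rewrite -cexpD addrC subrK.
rewrite distrC -[X in _ - X]mulr1 -mulrBr normrM zs.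
apply: (@le_lt_trans _ _ (s%:C * (r / (s + 1))%:C)).
  by apply: ler_wpM2l; [rewrite lecR | apply/ltW/dP; rewrite distrC].
by rewrite -rmorphM ltcR mulrA ltr_pdivrMr// mulrC ltr_pM2l//; lra.
Qed.

Lemma derive1_csin t : t != 0 ->
  derive1 (fun z : R[i] => csin (pi%:C * z / t)) 0 = pi%:C / t.
Proof.
move=> t0; pose a : R[i] := 'i * pi%:C / t.
have i0 : 'i != 0 :> R[i] := neq0Ci _.
have H : ((cexp (a * h) - 1) / h - (cexp (- a * h) - 1) / h) * (2 * 'i)^-1
    @[h --> (0 : R[i])^'] --> (a - - a) * (2 * 'i)^-1.
  apply: ccvgM; last exact: cvg_cst.
  by apply: ccvgB; exact: cexp_deriv0.
have -> : pi%:C / t = (a - - a) * (2 * 'i)^-1.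
  by rewrite /a; field; rewrite t0 i0.
rewrite /derive1; apply: ccvg_lim; apply: ccvg_near_eq H.
near=> h; rewrite addr0 mulr0 mul0r /csin mulr0 oppr0 subrr mul0r subr0.
have h0 : h != 0 by near: h; exact: nbhs_dnbhs_neq.
have -> : 'i * (pi%:C * h / t) = a * h by rewrite /a; field.
rewrite /GRing.scale /= (mulNr a h).
move: (cexp (a * h)) (cexp (- (a * h))) => E E'.
by field; rewrite h0 i0.
Unshelve. all: by end_near. Qed.

(** From $\sin x = e^{-ix}(e^{2ix} - 1)/2i$; the exponential prefactors are multiplicative and so
    cancel in the kernel. *)
Lemma csin_qnum t z : t != 0 ->
  csin (pi%:C * z / t) =
  pi%:C / t * qnum t z / cexp ('i * (pi%:C * z / t)).
Proof.
move=> t0; rewrite /csin /qnum /qexp cexpN.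
have iE : ipi = 'i * pi%:C :> R[i].
  by rewrite -complexiE /ipi; simpc.
have i0 : 'i != 0 :> R[i] := neq0Ci _.
have p0 : pi%:C != 0 :> R[i] by rewrite eq_complex negb_and /= gt_eqF ?pi_gt0.
have -> : 2 * ipi * z / t = 2%:R * ('i * (pi%:C * z / t)).
  by rewrite iE; field.
rewrite (cexpMn 2) iE; have := cexp_neq0 ('i * (pi%:C * z / t)).
move: (cexp _) => E E0; move: (pi%:C) p0 => p p0.
by field; rewrite E0 i0 t0 p0.
Qed.

(* This also holds at the poles, where both sides are [0] since [x / 0 = 0]. *)
Lemma Gth_csin t z w : t != 0 ->
  Gth (fun z : R[i] => csin (pi%:C * z / t)) z w =
  qnum t (z + w) / (qnum t z * qnum t w).
Proof.
move=> t0; rewrite /Gth derive1_csin// !csin_qnum//.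
have p0 : pi%:C != 0 :> R[i] by rewrite eq_complex negb_and /= gt_eqF ?pi_gt0.
have -> : 'i * (pi%:C * (z + w) / t) =
          'i * (pi%:C * z / t) + 'i * (pi%:C * w / t) by field.
rewrite cexpD.
have := cexp_neq0 ('i * (pi%:C * z / t)).
have := cexp_neq0 ('i * (pi%:C * w / t)).
move: (cexp ('i * (pi%:C * z / t))) (cexp ('i * (pi%:C * w / t))) => E F F0 E0.
move: (pi%:C) p0 => p p0.
move: (qnum t z) (qnum t w) => x y.
rewrite !invfM !invrK; move: x^-1 y^-1 => x' y'.
by field; rewrite E0 F0 t0 p0.
Qed.

Lemma Gth_id (z w : R[i]) : Gth (fun z : R[i] => z) z w = (z + w) / (z * w).
Proof.
suff d1 : derive1 (fun z : R[i] => z) 0 = (1 : R[i]) by rewrite /Gth d1 mul1r.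
rewrite /derive1; apply: ccvg_lim.
apply: (@ccvg_near_eq _ _ _ _ (fun=> 1)); last exact: cvg_cst.
near=> h; rewrite addr0 subr0 /GRing.scale /= mulVf//.
by near: h; exact: nbhs_dnbhs_neq.
Unshelve. all: by end_near. Qed.

End cexp_analysis.

(** * Matrices of operators on tensor squares and their limits *)

Lemma tensmx_unit0 (F : fieldType) n (A B : 'M[F]_n) :
  A \in unitmx -> B \in unitmx -> A *t B \in unitmx.
Proof.
case: n A B => [|n] A B; last exact: tensmx_unit.
by rewrite !unitmxE (@det_mx00 F (A *t B)) unitr1.
Qed.

Section tensor_representation.
Context {R : realType} {n : nat}.
Local Notation C := R[i].
Local Notation op := ((C -> C -> C) -> (C -> C -> C)).
Implicit Types (b : 'I_n -> C -> C) (Op : op) (M : 'M[C]_(n * n)).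

Lemma sum_mxtens (F : 'I_(n * n) -> C) :
  \sum_p F p = \sum_k \sum_l F (mxtens_index (k, l)).
Proof.
rewrite pair_bigA (reindex (@mxtens_index n n)) /=.
  by apply: eq_bigr => -[k l] _.
by exists (@mxtens_unindex n n) => p _; rewrite ?mxtens_indexK ?mxtens_unindexK.
Qed.

Definition basis_row b z1 z2 : 'rV[C]_(n * n) :=
  \row_p tens (b (mxtens_unindex p).1) (b (mxtens_unindex p).2) z1 z2.

Definition op_row Op b z1 z2 : 'rV[C]_(n * n) :=
  \row_p Op (tens (b (mxtens_unindex p).1) (b (mxtens_unindex p).2)) z1 z2.

(** Linearity is stated pointwise, so that it applies to any [G] with the same values as the linear
    combination. *)
Definition op_linear Op := forall (T : finType) (c : T -> C)
    (F : T -> C -> C -> C) (G : C -> C -> C),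
  (forall z1 z2, G z1 z2 = \sum_k c k * F k z1 z2) ->
  forall z1 z2, Op G z1 z2 = \sum_k c k * Op (F k) z1 z2.

(** A single set [U] serves all pairs of basis vectors, and the row form turns changes of basis and
    limits into matrix algebra. *)
Definition represents_on (U : set (C * C)) Op b M :=
  forall z, U z -> op_row Op b z.1 z.2 = basis_row b z.1 z.2 *m M.

Lemma represents_onE U Op b M z i j : represents_on U Op b M -> U z ->
  Op (tens (b i) (b j)) z.1 z.2 =
  \sum_k \sum_l M (mxtens_index (k, l)) (mxtens_index (i, j))
    * tens (b k) (b l) z.1 z.2.
Proof.
move=> UM Uz; have /rowP/(_ (mxtens_index (i, j))) := UM z Uz.
rewrite !mxE mxtens_indexK /= sum_mxtens => ->.
apply: eq_bigr => k _; apply: eq_bigr => l _.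
by rewrite mxE mxtens_indexK mulrC.
Qed.

Lemma represents_on_represents U Op b M : open U -> dense U ->
  represents_on U Op b M -> represents Op b M.
Proof.
by move=> oU dU UM i j; exists U; split=> // z; exact: represents_onE.
Qed.

(** A generalised Vandermonde matrix: its invertibility witnesses the linear independence of [b]. *)
Definition eval_mx b (x : 'I_n -> C) : 'M[C]_n := \matrix_(a, k) b k (x a).

Lemma tens_eval_mx b x y p q : (eval_mx b x *t eval_mx b y) p q =
  basis_row b (x (mxtens_unindex p).1) (y (mxtens_unindex p).2) 0 q.
Proof. by rewrite !mxE. Qed.

Lemma is_basis_fspan b x : eval_mx b x \in unitmx -> is_basis (fspan b) b.
Proof.
move=> xu; split=> // c c0 k.
suff /colP/(_ k) : \col_k c k = 0 by rewrite !mxE.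
rewrite -[LHS](mulKmx xu) (_ : eval_mx b x *m _ = 0) ?mulmx0//; apply/colP => a.
rewrite !mxE -[RHS](c0 (x a)); apply: eq_bigr => l _.
by rewrite !mxE mulrC.
Qed.

Lemma dense_eq0 (T : topologicalType) (U : set T) (g : T -> C) :
  dense U -> continuous g -> (forall z, U z -> g z = 0) -> forall z, g z = 0.
Proof.
move=> dU cg g0 z; apply: contrapT => /eqP gz0.
have gz : nbhs z [set w | g w != 0].
  exact: (@ccvg_neq0 _ _ (nbhs z) (nbhs_pfilter z) _ _ (cg z) gz0).
have [] := dU (interior [set w | g w != 0]) _ (open_interior _).
  by exists z.
by move=> w [/interior_subset /= + Uw]; rewrite g0// eqxx.
Qed.

Lemma continuous_tens (f g : C -> C) : continuous f -> continuous g ->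
  continuous (fun z : C * C => tens f g z.1 z.2).
Proof.
move=> cf cg z; apply: (@ccvgM _ _ (nbhs z) (nbhs_pfilter z)).
  by apply: (@continuous_comp _ _ _ fst f z); [exact: cvg_fst | exact: cf].
by apply: (@continuous_comp _ _ _ snd g z); [exact: cvg_snd | exact: cg].
Qed.

(* Two representing matrices agree on a dense set only; by continuity of the
   basis they agree on the grid [(x_a, y_b)], which need not lie in that set. *)
Lemma represents_unique Op b M N x y : (forall k, continuous (b k)) ->
  eval_mx b x \in unitmx -> eval_mx b y \in unitmx ->
  represents Op b M -> represents Op b N -> M = N.
Proof.
move=> cb xu yu MP NP.
have xyu : eval_mx b x *t eval_mx b y \in unitmx by exact: tensmx_unit0.
suff : (eval_mx b x *t eval_mx b y) *m (M - N) = 0.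
  move=> /(congr1 (mulmx (invmx (eval_mx b x *t eval_mx b y)))).
  by rewrite mulKmx// mulmx0 => /eqP; rewrite subr_eq0 => /eqP.
apply/matrixP => p q.
pose g z := \sum_s
  tens (b (mxtens_unindex s).1) (b (mxtens_unindex s).2) z.1 z.2 * (M - N) s q.
suff g0 z : g z = 0.
  rewrite mxE [RHS]mxE.
  rewrite -[RHS](g0 (x (mxtens_unindex p).1, y (mxtens_unindex p).2)).
  by apply: eq_bigr => s _; rewrite tens_eval_mx mxE.
have [[U [oU dU UP]] [V [oV dV VP]]] :=
  (MP (mxtens_unindex q).1 (mxtens_unindex q).2,
   NP (mxtens_unindex q).1 (mxtens_unindex q).2).
apply: (@dense_eq0 _ (U `&` V)).
- exact: denseI.
- move=> {}z; apply: (@ccvg_sum _ _ (nbhs z) (nbhs_pfilter z)) => s.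
  apply: (@ccvgM _ _ (nbhs z) (nbhs_pfilter z)); last exact: cvg_cst.
  exact: continuous_tens.
- move=> {}z [/UP Uz /VP Vz]; have := etrans (esym Uz) Vz.
  rewrite -!surjective_pairing mxtens_unindexK => /eqP.
  rewrite -subr_eq0 => /eqP <-.
  rewrite /g sum_mxtens -sumrB; apply: eq_bigr => k _.
  rewrite -sumrB; apply: eq_bigr => l _.
  by rewrite mxtens_indexK !mxE mulrC mulrBl.
Qed.

(** [rep_mx] chooses some representing matrix; [M] shows that one exists, and uniqueness identifies
    the choice with [M]. *)
Lemma rep_mx_represents Op b M x y : (forall k, continuous (b k)) ->
  eval_mx b x \in unitmx -> eval_mx b y \in unitmx ->
  represents Op b M -> rep_mx Op b = M.
Proof.
move=> cb xu yu MP; apply: (represents_unique cb xu yu _ MP).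
exact: (@xgetPex _ 0 (represents Op b) (ex_intro _ M MP)).
Qed.

(** If $F$ has coordinate column [e] in the products of basis elements, then its image has
    coordinates [M *m e]. *)
Lemma represents_on_invariant U Op b M : op_linear Op -> open U -> dense U ->
  represents_on U Op b M -> invariant_under Op (tens_sq (fspan b)).
Proof.
move=> lin oU dU UM F [m [f [g [fgV FE]]]].
have /choice[c cP] : forall i, exists c : 'I_n -> C, forall z,
  f i z = \sum_k c k * b k z by move=> i; have [] := fgV i.
have /choice[d dP] : forall i, exists c : 'I_n -> C, forall z,
  g i z = \sum_k c k * b k z by move=> i; have [] := fgV i.
pose e : 'cV[C]_(n * n) :=
  \col_p \sum_i c i (mxtens_unindex p).1 * d i (mxtens_unindex p).2.
have {}FE z1 z2 : F z1 z2 = \sum_p e p 0 *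
    tens (b (mxtens_unindex p).1) (b (mxtens_unindex p).2) z1 z2.
  rewrite FE sum_mxtens.
  under [RHS]eq_bigr do under eq_bigr do rewrite mxE mxtens_indexK mulr_suml.
  under [RHS]eq_bigr do rewrite exchange_big.
  rewrite [RHS]exchange_big; apply: eq_bigr => i _.
  rewrite /tens cP dP mulr_suml; apply: eq_bigr => k _.
  rewrite mulr_sumr; apply: eq_bigr => l _.
  by rewrite mulrACA.
exists (fun z1 z2 => (basis_row b z1 z2 *m (M *m e)) 0 0).
  exists (n * n)%N, (fun p z => (M *m e) p 0 * b (mxtens_unindex p).1 z),
    (fun p => b (mxtens_unindex p).2); split=> [p|z1 z2].
    split.
      exists (fun k => (M *m e) p 0 * (k == (mxtens_unindex p).1)%:R) => z.
      rewrite (bigD1 (mxtens_unindex p).1)//= eqxx mulr1 big1 ?addr0// => k.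
      by move=> /negPf ->; rewrite mulr0 mul0r.
    exists (fun k => (k == (mxtens_unindex p).2)%:R) => z.
    rewrite (bigD1 (mxtens_unindex p).2)//= eqxx mul1r big1 ?addr0// => k.
    by move=> /negPf ->; rewrite mul0r.
  rewrite mxE; apply: eq_bigr => p _; rewrite [basis_row _ _ _ _ _]mxE /tens.
  by rewrite mulrC mulrA.
exists U; split=> // z Uz; rewrite (lin _ _ _ _ FE) mulmxA -UM// [RHS]mxE.
by apply: eq_bigr => p _; rewrite [op_row _ _ _ _ _ _]mxE mulrC.
Qed.

(** Both the basis row and the operator row are multiplied on the right by [H *t H], the latter by
    linearity. *)
Lemma represents_on_basis_change U Op b b' M (H : 'M[C]_n) : op_linear Op ->
  H \in unitmx -> (forall k z, b' k z = \sum_a H a k * b a z) ->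
  represents_on U Op b M ->
  represents_on U Op b' (invmx (H *t H) *m M *m (H *t H)).
Proof.
move=> lin Hu b'E UM z Uz.
have HHu : H *t H \in unitmx by exact: tensmx_unit0.
have tE i j z1 z2 : tens (b' i) (b' j) z1 z2 = \sum_p
    (H *t H) p (mxtens_index (i, j)) *
    tens (b (mxtens_unindex p).1) (b (mxtens_unindex p).2) z1 z2.
  rewrite sum_mxtens /tens !b'E mulr_suml; apply: eq_bigr => k _.
  rewrite mulr_sumr; apply: eq_bigr => l _.
  by rewrite !mxE !mxtens_indexK /= mulrACA.
have bE : basis_row b' z.1 z.2 = basis_row b z.1 z.2 *m (H *t H).
  apply/rowP => p; rewrite [LHS]mxE tE -surjective_pairing mxtens_unindexK mxE.
  by apply: eq_bigr => q _; rewrite [basis_row _ _ _ _ _]mxE mulrC.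
have oE : op_row Op b' z.1 z.2 = op_row Op b z.1 z.2 *m (H *t H).
  apply/rowP => p; rewrite [LHS]mxE (lin _ _ _ _ (tE _ _)).
  rewrite -surjective_pairing mxtens_unindexK mxE.
  by apply: eq_bigr => q _; rewrite [op_row _ _ _ _ _ _]mxE mulrC.
by rewrite bE oE UM// !mulmxA mulmxK.
Qed.

End tensor_representation.

Lemma ccvg_basis_row (R : realType) (n : nat) (b : R[i] -> 'I_n -> R[i] -> R[i])
    (b0 : 'I_n -> R[i] -> R[i]) z1 z2 i j :
  (forall k z, b t k z @[t --> cinfty] --> b0 k z) ->
  basis_row (b t) z1 z2 i j @[t --> cinfty] --> basis_row b0 z1 z2 i j.
Proof.
move=> bb0; under eq_fun do rewrite mxE; rewrite mxE.
by apply: ccvgM; exact: bb0.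
Qed.

(* The sets [U t] and [U0] are the complements of the poles of [Op t] and [Op0].
   That [Op0] leaves its space invariant is a consequence, not a hypothesis. *)
Lemma degeneration (R : realType) (n : nat)
    (Op : R[i] -> (R[i] -> R[i] -> R[i]) -> (R[i] -> R[i] -> R[i]))
    (Op0 : (R[i] -> R[i] -> R[i]) -> (R[i] -> R[i] -> R[i]))
    (V : R[i] -> set (R[i] -> R[i])) (V0 : set (R[i] -> R[i]))
    (b : R[i] -> 'I_n -> R[i] -> R[i]) (b0 : 'I_n -> R[i] -> R[i])
    (U : R[i] -> set (R[i] * R[i])) (U0 : set (R[i] * R[i]))
    (M : R[i] -> 'M[R[i]]_(n * n)) (x y : 'I_n -> R[i]) :
  (\forall t \near cinfty, V t = fspan (b t)) -> V0 = fspan b0 ->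
  (forall k z, b t k z @[t --> cinfty] --> b0 k z) ->
  (forall t k, continuous (b t k)) -> (forall k, continuous (b0 k)) ->
  eval_mx b0 x \in unitmx -> eval_mx b0 y \in unitmx ->
  (forall t, op_linear (Op t)) -> op_linear Op0 ->
  (\forall t \near cinfty, open (U t) /\ dense (U t)) ->
  open U0 -> dense U0 -> (forall i j, U0 (x i, y j)) ->
  (forall z, U0 z -> \forall t \near cinfty, U t z) ->
  (forall z, U0 z -> forall i j,
    Op t (tens (b t i) (b t j)) z.1 z.2 @[t --> cinfty] -->
    Op0 (tens (b0 i) (b0 j)) z.1 z.2) ->
  (\forall t \near cinfty, represents_on (U t) (Op t) (b t) (M t)) ->
  rep_degenerates Op V b Op0 V0 b0 /\
  M t @[t --> cinfty] --> rep_mx Op0 b0.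
Proof.
move=> VE V0E bb0 cb cb0 x0u y0u lin lin0 Uod oU0 dU0 gridU0 U0U opcvg MP.
have evcvg w i j : eval_mx (b t) w i j @[t --> cinfty] --> eval_mx b0 w i j.
  by under eq_fun do rewrite mxE; rewrite mxE; exact: bb0.
have xu : \forall t \near cinfty, eval_mx (b t) x \in unitmx.
  exact: ccvg_unitmx x0u.
have yu : \forall t \near cinfty, eval_mx (b t) y \in unitmx.
  exact: ccvg_unitmx y0u.
pose B t := eval_mx (b t) x *t eval_mx (b t) y.
pose B0 := eval_mx b0 x *t eval_mx b0 y.
have B0u : B0 \in unitmx by exact: tensmx_unit0.
have BB0 i j : B t i j @[t --> cinfty] --> B0 i j.
  under eq_fun do rewrite tens_eval_mx; rewrite /B0 tens_eval_mx.
  exact: ccvg_basis_row.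
pose pt p := (x (@mxtens_unindex n n p).1, y (@mxtens_unindex n n p).2).
pose A t : 'M[R[i]]_(n * n) :=
  \matrix_(p, q) op_row (Op t) (b t) (pt p).1 (pt p).2 0 q.
pose A0 : 'M[R[i]]_(n * n) :=
  \matrix_(p, q) op_row Op0 b0 (pt p).1 (pt p).2 0 q.
have AA0 i j : A t i j @[t --> cinfty] --> A0 i j.
  under eq_fun do rewrite !mxE; rewrite !mxE.
  by apply: opcvg; exact: gridU0.
pose M0 := invmx B0 *m A0.
have MM0 i j : M t i j @[t --> cinfty] --> M0 i j.
  apply: (@ccvg_near_eq _ _ _ _ (fun t => (invmx (B t) *m A t) i j));
    last exact: (ccvg_mulmx (ccvg_invmx BB0 B0u) AA0).
  (* The grid is finite and lies in [U0], so eventually all its points lie in [U t] at once. *)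
  have Upt : \forall t \near cinfty, forall p, U t (pt p).
    by apply: filter_forall => p; apply: U0U; exact: gridU0.
  near=> t.
  have Bu : B t \in unitmx.
    by near: t; apply: filterS2 xu yu => t; exact: tensmx_unit0.
  (* On the grid the representation is a linear system that determines [M t]. *)
  suff -> : A t = B t *m M t by rewrite mulKmx.
  have Mt : represents_on (U t) (Op t) (b t) (M t) by near: t.
  have Ut : forall p, U t (pt p) by near: t.
  apply/matrixP => p q; rewrite mxE Mt; last exact: Ut.
  by rewrite !mxE; apply: eq_bigr => k _; rewrite tens_eval_mx.
have M0P : represents_on U0 Op0 b0 M0.
  move=> z Uz; apply/rowP => p.
  (* At a fixed [z] in [U0] both sides are limits of the same function of [t], since [z] eventually
     lies in [U t]. *)
  apply: (@ccvg_unique _ _ cinfty _ (fun t => op_row (Op t) (b t) z.1 z.2 0 p)).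
    by under eq_fun do rewrite mxE; rewrite mxE; exact: opcvg.
  apply: (@ccvg_near_eq _ _ _ _
    (fun t => (basis_row (b t) z.1 z.2 *m M t) 0 p)).
    near=> t; have Mt : represents_on (U t) (Op t) (b t) (M t) by near: t.
    by rewrite Mt//; near: t; exact: U0U.
  apply: ccvg_mulmx; last exact: MM0.
  by move=> k l; exact: ccvg_basis_row.
have M0E : rep_mx Op0 b0 = M0.
  apply: (rep_mx_represents cb0 x0u y0u).
  exact: represents_on_represents M0P.
have McvgM0 : M t @[t --> cinfty] --> rep_mx Op0 b0.
  by rewrite M0E; exact: cvg_mx.
split; last exact: McvgM0.
split.
- near=> t.
  have [oU dU] : open (U t) /\ dense (U t) by near: t.
  have -> : V t = fspan (b t) by near: t.
  have Mt : represents_on (U t) (Op t) (b t) (M t) by near: t.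
  split; last exact: (represents_on_invariant (lin t) oU dU Mt).
  by apply: (@is_basis_fspan _ _ _ x); near: t; exact: xu.
- rewrite V0E; split; first exact: is_basis_fspan x0u.
  exact: (represents_on_invariant lin0 oU0 dU0 M0P).
- exact: bb0.
- apply: cvg_trans McvgM0; apply: near_eq_cvg; near=> t.
  have [oU dU] : open (U t) /\ dense (U t) by near: t.
  have Mt : represents_on (U t) (Op t) (b t) (M t) by near: t.
  symmetry; apply: (rep_mx_represents (cb t)).
  + by near: t; exact: xu.
  + by near: t; exact: yu.
  + exact: (represents_on_represents oU dU Mt).
Unshelve. all: by end_near. Qed.

(** * The Cremmer-Gervais matrix *)

(** With $h(k) = P^k Q^{i+j+1-k}$, each summand times $P - Q$ equals $h(k+1) - h(k)$, so the sum
    telescopes. *)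
Lemma sum_geom_mixed (F : fieldType) (P Q : F) (i j : nat) : (i <= j)%N ->
  (P - Q) * (\sum_(i <= k < j) P ^+ k * Q ^+ (i + j - k)) =
  Q * (Q ^+ i * P ^+ j - P ^+ i * Q ^+ j).
Proof.
move=> ij; pose h k := P ^+ k * Q ^+ ((i + j).+1 - k).
rewrite mulr_sumr.
rewrite (eq_big_nat _ _ (F2 := fun k => h k.+1 - h k)) => [|k /andP[ik kj]].
  rewrite telescope_sumr// /h (_ : ((i + j).+1 - j = i.+1)%N); last by lia.
  by rewrite (_ : ((i + j).+1 - i = j.+1)%N) ?exprS; [ring | lia].
rewrite /h subSS (_ : ((i + j).+1 - k = (i + j - k).+1)%N); last by lia.
by rewrite !exprS; ring.
Qed.

Section CG_sum.
Variables (F : fieldType) (n : nat).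
Implicit Types (P Q a c : F) (i j k l : 'I_n).

(* The coefficient of [P^k Q^l] in
   [(x a' - 1) / ((x - 1) (a' - 1)) Q^i P^j
    - (x c' - 1) / ((x - 1) (c' - 1)) P^i Q^j]
   for [x = P / Q], [a = a' / (a' - 1)], [c = c' / (c' - 1)]. *)
Definition CG_frac a c i j k l : F :=
  ((k == j) && (l == i))%:R * a - ((k == i) && (l == j))%:R * c
  + (i + j == k + l)%N%:R * ((i <= k < j)%N%:R - (j <= k < i)%N%:R).

Lemma CG_frac_eq0 a c i j k l : (i + j != k + l)%N -> CG_frac a c i j k l = 0.
Proof.
move=> ijkl; rewrite /CG_frac (negPf ijkl) mul0r addr0.
have -> : (k == j) && (l == i) = false.
  by apply/negP => /andP[/eqP kj /eqP li]; move: ijkl; rewrite kj li addnC eqxx.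
have -> : (k == i) && (l == j) = false.
  by apply/negP => /andP[/eqP kj /eqP li]; move: ijkl; rewrite kj li eqxx.
by rewrite !mul0r subrr.
Qed.

Lemma sum_delta2 (f : 'I_n -> 'I_n -> F) i j :
  \sum_k \sum_l ((k == i) && (l == j))%:R * f k l = f i j.
Proof.
rewrite (bigD1 i)//= [X in _ + X]big1 => [|k /negPf ki]; last first.
  by apply: big1 => l _; rewrite ki mul0r.
rewrite addr0 (bigD1 j)//= [X in _ + X]big1 => [|l /negPf lj]; last first.
  by rewrite lj andbF mul0r.
by rewrite addr0 !eqxx mul1r.
Qed.

(** For $i \le k < j$ only $l = i + j - k$ survives, and it is at most $j$, hence below $n$. *)
Lemma sum_antidiag (f : nat -> nat -> F) i j :
  \sum_(k < n) \sum_(l < n) (i + j == k + l)%N%:R * (i <= k < j)%N%:R * f k l =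
  \sum_(i <= k < j) f k (i + j - k)%N.
Proof.
rewrite (@big_nat_widenl _ _ _ i 0)//.
rewrite (@big_nat_widen _ _ _ 0 j n); last exact: ltnW.
rewrite big_mkord [RHS]big_mkcond; apply: eq_bigr => k _ /=.
rewrite andbC; case: ifPn => ikj; last first.
  by apply: big1 => l _; rewrite mulr0 mul0r.
have ln : (i + j - k < n)%N by have := ltn_ord j; lia.
rewrite (bigD1 (Ordinal ln))//= [X in _ + X]big1 ?addr0 => [|l lk].
  by rewrite (_ : (i + j == k + (i + j - k))%N) ?mul1r//; lia.
rewrite (_ : (i + j == k + l)%N = false) ?mul0r//.
by apply: contra_neqF lk => /eqP ijk; apply/val_inj => /=; lia.
Qed.

Lemma sum_CG_frac P Q a c i j : P != Q ->
  \sum_k \sum_l CG_frac a c i j k l * (P ^+ k * Q ^+ l) =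
  a * (P ^+ j * Q ^+ i) - c * (P ^+ i * Q ^+ j)
  + Q / (P - Q) * (Q ^+ i * P ^+ j - P ^+ i * Q ^+ j).
Proof.
move=> PQ; have PQ0 : P - Q != 0 by rewrite subr_eq0.
pose f (k l : nat) := P ^+ k * Q ^+ l.
under eq_bigr do under eq_bigr do rewrite /CG_frac mulrDl mulrBl mulrBr mulrBl.
transitivity (
   \sum_(k < n) \sum_(l < n) ((k == j) && (l == i))%:R * (a * f k l)
 - \sum_(k < n) \sum_(l < n) ((k == i) && (l == j))%:R * (c * f k l)
 + (\sum_(k < n) \sum_(l < n)
      (i + j == k + l)%N%:R * (i <= k < j)%N%:R * f k l
    - \sum_(k < n) \sum_(l < n)
      (i + j == k + l)%N%:R * (j <= k < i)%N%:R * f k l)).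
  rewrite -!sumrB -big_split; apply: eq_bigr => k _.
  rewrite -!sumrB -big_split; apply: eq_bigr => l _.
  by rewrite /f /=; ring.
rewrite (sum_delta2 (fun k l => a * f k l)) (sum_delta2 (fun k l => c * f k l)).
rewrite (sum_antidiag f) addnC (sum_antidiag f) addnC /f; congr (_ - _ + _).
(* At most one of the two intervals is nonempty; for $j < i$ the same telescoping sum appears with
   $i$ and $j$ exchanged and a minus sign. *)
have [ij|ji] := leqP i j.
  rewrite [X in _ - X]big_geq// subr0.
  by apply: (mulfI PQ0); rewrite sum_geom_mixed//; field.
rewrite [X in X - _]big_geq ?(ltnW ji)// sub0r.
apply: (mulfI PQ0); rewrite mulrN addnC sum_geom_mixed ?(ltnW ji)//; field.
exact: PQ0.
Qed.

End CG_sum.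

Section CG_matrix.
Context {R : realType}.
Implicit Types (tau kappa alpha beta lam z w : R[i]).

(** The half-open intervals of [CG_frac] contain their lower endpoint, so for $i \ne j$ and $k =
    \min(i,j)$ the value $-c$ becomes $1 - c$, or $a$ becomes $a - 1$. This inverts $q$ or $\eta$
    and accounts for the exponents [sgz]. *)
Lemma CG_cases_frac n (q eta : R[i]) (i j k l : 'I_n) :
  q != 0 -> eta != 0 -> q ^+ 2 != 1 -> eta ^+ 2 != 1 ->
  (if [&& i == j, j == k & k == l] then q * eta^-1 - q^-1 * eta
   else if [&& i == k, k != l & l == j] then
     - hatc eta * q ^ sgz (i%:Z - j%:Z)
   else if (minn i j < k < maxn i j)%N && (i + j == k + l)%N then
     (sgz (j%:Z - i%:Z))%:~R * hatc eta * hatc q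
   else if [&& j == k, k != l & l == i] then
     hatc q * eta ^ sgz (j%:Z - i%:Z)
   else 0) =
  hatc q * hatc eta *
  CG_frac (eta ^+ 2 / (eta ^+ 2 - 1)) (q ^+ 2 / (q ^+ 2 - 1)) i j k l.
Proof.
move=> q0 e0 q1 e1.
have q1' : q ^+ 2 - 1 != 0 by rewrite subr_eq0.
have e1' : eta ^+ 2 - 1 != 0 by rewrite subr_eq0.
have [ijkl|ijkl] := eqVneq (i + j)%N (k + l)%N; last first.
  rewrite CG_frac_eq0// mulr0 andbF -!val_eqE /=.
  by rewrite !ifF//; lia.
rewrite /CG_frac ijkl eqxx mul1r andbT -!val_eqE /= /hatc.
rewrite (eq_sym (i : nat) k) (eq_sym (j : nat) k).
have -> : ((l : nat) == i) = ((k : nat) == j) by lia.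
have -> : ((l : nat) == j) = ((k : nat) == i) by lia.
rewrite !andbb; move: ijkl.
move: (nat_of_ord i) (nat_of_ord j) (nat_of_ord k) (nat_of_ord l).
move=> {}i {}j {}k {}l ijkl.
have [ij|ji|ij] := ltngtP i j.
- have -> : sgz (i%:Z - j%:Z) = -1 by rewrite ltr0_sgz// subr_lt0 ltz_nat.
  have -> : sgz (j%:Z - i%:Z) = 1 by rewrite gtr0_sgz// subr_gt0 ltz_nat.
  rewrite (_ : (k != l) && (k == i) = (k == i)) ?andbb; last by lia.
  rewrite (_ : (k != l) && (k == j) = (k == j)) ?andbb; last by lia.
  rewrite (_ : (j <= k < i)%N = false) ?subr0; last by lia.
  have [ki|ki|ki] := ltngtP k i; have [kj|kj|kj] := ltngtP k j => /=;
    try (exfalso; lia); rewrite ?mulr0n ?mulr1n.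
  + by ring.
  + by ring.
  + by ring.
  + by rewrite expr1z; field; rewrite q0 e0 q1' e1'.
  + by rewrite exprN1; field; rewrite q0 e0 q1' e1'.
- have -> : sgz (i%:Z - j%:Z) = 1 by rewrite gtr0_sgz// subr_gt0 ltz_nat.
  have -> : sgz (j%:Z - i%:Z) = -1 by rewrite ltr0_sgz// subr_lt0 ltz_nat.
  rewrite (_ : (k != l) && (k == i) = (k == i)) ?andbb; last by lia.
  rewrite (_ : (k != l) && (k == j) = (k == j)) ?andbb; last by lia.
  rewrite (_ : (i <= k < j)%N = false) ?sub0r; last by lia.
  have [ki|ki|ki] := ltngtP k i; have [kj|kj|kj] := ltngtP k j => /=;
    try (exfalso; lia); rewrite ?mulr0n ?mulr1n.
  + by ring.
  + by ring.
  + by rewrite exprN1; field; rewrite q0 e0 q1' e1'.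
  + by ring.
  + by rewrite expr1z; field; rewrite q0 e0 q1' e1'.
- subst j; rewrite (_ : (i <= k < i)%N = false); last by lia.
  rewrite (_ : (i < k < i)%N = false); last by lia.
  have [ki|ki] := eqVneq k i => /=; last by ring.
  rewrite (_ : (k == l) = true) ?mulr1n; last by lia.
  by field; rewrite q0 e0 q1' e1'.
Qed.

(** Lowering $\beta$ by $\kappa/2n$ cancels the powers of $p$, and [CG_norm] cancels the product of
    the two [hatc]; what remains of $q$ and $\eta$ are their squares, which are values of [qexp]. *)
Lemma tCG_coef_frac n tau kappa alpha beta lam (i j k l : 'I_n) :
  tau != 0 -> qexp tau kappa != 1 -> qexp tau lam != 1 ->
  CG_norm tau kappa lam
    * tCG_coef tau kappa alpha (beta - kappa / (2 * n%:R)) lam i j k l =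
  2 * ipi / tau * qexp tau (2 * alpha * lam) ^ (i%:Z - k%:Z)
    * qexp tau (2 * beta) ^ (j%:Z - k%:Z)
    * CG_frac (qexp tau lam / (qexp tau lam - 1))
        (qexp tau kappa / (qexp tau kappa - 1)) i j k l.
Proof.
move=> t0 k1 l1; rewrite /CG_norm /tCG_coef /CG_coef.
have qE : qexp tau kappa = qCG tau kappa ^+ 2.
  by rewrite /qCG -cexpMn /qexp; congr cexp; field.
have eE : qexp tau lam = etaCG tau lam ^+ 2.
  by rewrite /etaCG -cexpMn /qexp; congr cexp; field.
have q0 : qCG tau kappa != 0 := cexp_neq0 _.
have e0 : etaCG tau lam != 0 := cexp_neq0 _.
have hatc_neq0 x : x != 0 -> x ^+ 2 != 1 -> hatc x != 0 :> R[i].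
  move=> x0 x1; apply: contra_neq x1; rewrite /hatc => /eqP.
  by rewrite subr_eq0 => /eqP xV; rewrite expr2 {2}xV mulfV.
rewrite CG_cases_frac -?qE -?eE//.
have hq : hatc (qCG tau kappa) != 0 by rewrite hatc_neq0// -qE.
have he : hatc (etaCG tau lam) != 0 by rewrite hatc_neq0// -eE.
have -> : zetaCG tau alpha lam ^ (2 * (i%:Z - k%:Z)) =
    qexp tau (2 * alpha * lam) ^ (i%:Z - k%:Z).
  rewrite /zetaCG /qexp -!cexpMz; congr cexp.
  by move: (i%:Z - k%:Z) => m; rewrite intrM; field.
have n0 : n%:R != 0 :> R[i].
  by rewrite pnatr_eq0 -lt0n (leq_ltn_trans _ (ltn_ord i)).
have -> : qexp tau (2 * beta) ^ (j%:Z - k%:Z) =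
    gammaCG tau (beta - kappa / (2 * n%:R)) ^ (2 * (j%:Z - k%:Z)) *
    pCG n tau kappa ^ (2 * (j%:Z - k%:Z)).
  rewrite /gammaCG /pCG /qexp -!cexpMz -cexpD; congr cexp.
  by move: (j%:Z - k%:Z) => m; rewrite intrM; field; rewrite t0 n0.
move: (CG_frac _ _ _ _ _ _) (_ ^ _) (_ ^ _) (_ ^ _) => D x y z.
by field; rewrite t0 hq he.
Qed.

Lemma phi_qexp n tau (k : 'I_n) z :
  phi tau k z = qexp tau (- ((n%:R - 1) / 2) * z) * qexp tau z ^+ k.
Proof.
rewrite /phi /qexp -cexpMn -cexpD; congr cexp; ring.
Qed.

Lemma Gth_csin_qexp tau z w : tau != 0 ->
  Gth (fun z : R[i] => csin (pi%:C * z / tau)) z w =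
  2 * ipi / tau * (qexp tau z * qexp tau w - 1)
    / ((qexp tau z - 1) * (qexp tau w - 1)).
Proof.
move=> t0; rewrite Gth_csin// /qnum qexpD; have := ipi_neq0 (R := R).
move: (2 * ipi) (qexp tau z) (qexp tau w) => u x y u0.
have [->|x1] := eqVneq (x - 1) 0; first by rewrite !(mulr0, mul0r, invr0).
have [->|y1] := eqVneq (y - 1) 0; first by rewrite !(mulr0, mul0r, invr0).
by field; rewrite t0 u0 x1 y1.
Qed.

Lemma represents_phi n tau kappa alpha beta lam :
  tau != 0 -> qexp tau kappa != 1 -> qexp tau lam != 1 ->
  represents_on
    [set z | qexp tau (z.1 - z.2 - 2 * (alpha * lam + beta)) != 1]
    (SUt tau kappa alpha beta lam) (phi (n := n) tau)
    (CG_norm tau kappa lam *: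
     R_CG n tau kappa alpha (beta - kappa / (2 * n%:R)) lam).
Proof.
move=> t0 k1 l1 [z1 z2] /= w1; apply/rowP => p.
rewrite !mxE sum_mxtens; set i := (mxtens_unindex p).1; set j := _.2.
under eq_bigr do under eq_bigr do
  rewrite !mxE mxtens_indexK /= tCG_coef_frac// mulrC.
rewrite /SUt /SU !Gth_csin_qexp//.
pose s := qexp tau (2 * alpha * lam); pose g := qexp tau (2 * beta).
(* The exponential of the kernel argument becomes $P/Q$, and those of the evaluation points become
   $(Q, Pr)$ and $(P, Qr)$ with $r = g/s$. *)
pose P := qexp tau (z1 - 2 * beta); pose Q := qexp tau (z2 + 2 * alpha * lam).
have s0 : s != 0 := qexp_neq0 _ _.
have g0 : g != 0 := qexp_neq0 _ _.
have P0 : P != 0 := qexp_neq0 _ _.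
have Q0 : Q != 0 := qexp_neq0 _ _.
have wE : qexp tau (z1 - z2 - 2 * (alpha * lam + beta)) = P / Q.
  by rewrite /P /Q -qexpB; congr qexp; ring.
move: w1; rewrite wE => w1.
have PQ : P != Q by apply: contra_neq w1 => ->; rewrite mulfV.
(* All evaluation points have the same coordinate sum, so the factors of [phi] that do not depend on
   the index combine into one common [K]. *)
pose K := qexp tau (- ((n%:R - 1) / 2) * (z1 + z2)).
have tE u v : u + v = z1 + z2 -> forall a b : 'I_n,
    tens (phi tau a) (phi tau b) u v = K * (qexp tau u ^+ a * qexp tau v ^+ b).
  move=> uv a b; rewrite /tens !phi_qexp mulrACA -qexpD -mulrDr uv.
  by rewrite /K.
rewrite !tE; try ring.
have [r rE] : exists r, r = g / s by exists (g / s).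
have -> : qexp tau (z1 - 2 * alpha * lam) = P * r.
  by rewrite rE /P /g /s -qexpB -qexpD; congr qexp; ring.
have -> : qexp tau (z2 + 2 * beta) = Q * r.
  by rewrite rE /Q /g /s -qexpB -qexpD; congr qexp; ring.
rewrite -/Q -/P !exprMn.
(* Both terms contain $r^j$; the rest is the expression summed by [sum_CG_frac]. *)
transitivity (2 * ipi / tau * K * r ^+ j *
   \sum_(k < n) \sum_(l < n) CG_frac (qexp tau lam / (qexp tau lam - 1))
        (qexp tau kappa / (qexp tau kappa - 1)) i j k l * (P ^+ k * Q ^+ l)).
  rewrite sum_CG_frac//.
  have : qexp tau kappa - 1 != 0 by rewrite subr_eq0.
  have : qexp tau lam - 1 != 0 by rewrite subr_eq0.
  have PQ' : P - Q != 0 by rewrite subr_eq0.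
  move: (qexp tau kappa) (qexp tau lam) (r ^+ j) => a b c b1 a1.
  move: (P ^+ i) (P ^+ j) (Q ^+ i) (Q ^+ j) => pi pj qi qj.
  by field; rewrite t0 a1 b1 PQ' Q0.
rewrite mulr_sumr; apply: eq_bigr => k _.
rewrite mulr_sumr; apply: eq_bigr => l _.
rewrite (tE z1 z2 erefl).
(* For $i + j = k + l$ one has $s^{i-k} = s^{l-j}$, so the twists together with $e_\tau(z_1) = Pg$,
   $e_\tau(z_2) = Q/s$ leave exactly $r^j$. *)
have [ijkl|ijkl] := eqVneq (i + j)%N (k + l)%N; last first.
  by rewrite (CG_frac_eq0 _ _ ijkl) mulr0 !mul0r mulr0.
have -> : qexp tau z1 = P * g by rewrite /P /g -qexpD subrK.
have -> : qexp tau z2 = Q / s by rewrite /Q /s -qexpB addrK.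
rewrite -/s -/g rE.
have -> : s ^ (i%:Z - k%:Z) = s ^+ l / s ^+ j.
  by rewrite exprnN exprnP -expfzDr//; congr (_ ^ _); lia.
have -> : g ^ (j%:Z - k%:Z) = g ^+ j / g ^+ k.
  by rewrite expfzDr// -exprnN.
rewrite !exprMn !exprVn.
have sj0 := expf_neq0 j s0; have sl0 := expf_neq0 l s0.
have gk0 := expf_neq0 k g0.
move: (CG_frac _ _ _ _ _ _) sj0 sl0 gk0 => D.
move: (s ^+ j) (s ^+ l) (g ^+ k) (g ^+ j) (P ^+ k) (Q ^+ l).
by move=> sj sl gk gj pk ql sj0 sl0 gk0; field; rewrite t0 sj0 sl0 gk0.
Qed.

End CG_matrix.

(** * The Shibukawa-Ueno operators *)

Section shibukawa_ueno.
Context {R : realType}.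
Implicit Types (tau kappa alpha beta lam z w : R[i]).

Lemma SU_linear theta kappa alpha beta lam :
  op_linear (SU theta kappa alpha beta lam).
Proof.
move=> T c F G GE z1 z2; rewrite /SU !GE !mulr_sumr -sumrB.
by apply: eq_bigr => k _; ring.
Qed.

Lemma phit_phi n tau (k : 'I_n) z :
  phit tau k z = \sum_a Hmx n tau a k * phi tau a z.
Proof.
by apply: eq_bigr => l _; rewrite mxE; congr (_ * _ * _); exact: mulrC.
Qed.

(** The binomial theorem for $(e_\tau(z) - 1)^k$; the sum over $l < n$ stops at $k$ because later
    binomial coefficients vanish. *)
Lemma phit_qnum n tau (k : 'I_n) z :
  phit tau k z = qexp tau (- ((n%:R - 1) / 2) * z) * qnum tau z ^+ k.
Proof.
rewrite /phit /qnum [in RHS]exprMn (addrC (qexp tau z)) exprDn.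
under eq_bigr do rewrite phi_qexp.
rewrite !mulr_sumr -(big_mkord xpredT (fun l : nat => (-1) ^ (k%:Z - l%:Z) *
  (tau / (2 * ipi)) ^+ k * 'C(k, l)%:R *
  (qexp tau (- ((n%:R - 1) / 2) * z) * qexp tau z ^+ l))).
rewrite (big_cat_nat _ (n := k.+1))//= [X in _ + X]big1_seq ?addr0; last first.
  move=> l /=; rewrite mem_index_iota => /andP[kl _].
  by rewrite bin_small// mulr0 mul0r.
rewrite big_mkord; apply: eq_bigr => l _.
have lk : (l <= k)%N by rewrite -ltnS.
by rewrite subzn// -exprnP -mulr_natr; ring.
Qed.

Lemma phit_cvg n (k : 'I_n) z : phit tau k z @[tau --> cinfty] --> mono k z.
Proof.
under eq_fun do rewrite phit_qnum; rewrite -[mono k z]mul1r.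
by apply: ccvgM; [exact: cexp_div_cvg | apply: ccvgX; exact: qnum_cvg].
Qed.

Lemma continuous_cexp_div tau a : continuous (fun z => cexp (a * z / tau)).
Proof.
move=> z; apply: (@continuous_comp _ _ _ (fun z => a * z / tau) cexp).
  apply: (@ccvgM _ _ (nbhs z) (nbhs_pfilter z)); last exact: cvg_cst.
  apply: (@ccvgM _ _ (nbhs z) (nbhs_pfilter z)); first exact: cvg_cst.
  exact: cvg_id.
exact: continuous_cexp.
Qed.

Lemma continuous_phit n tau (k : 'I_n) : continuous (phit tau k).
Proof.
move=> z; apply: (@ccvg_sum _ _ (nbhs z) (nbhs_pfilter z)) => l.
apply: (@ccvgM _ _ (nbhs z) (nbhs_pfilter z)); first exact: cvg_cst.
exact: continuous_cexp_div.
Qed.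

Lemma continuous_mono n (k : 'I_n) : continuous (@mono R n k).
Proof.
by move=> z; apply: (@ccvgX _ _ (nbhs z) (nbhs_pfilter z)); exact: cvg_id.
Qed.

Lemma eval_mx_mono_unit n (x : 'I_n -> R[i]) : injective x ->
  eval_mx (@mono R n) x \in unitmx.
Proof.
move=> xi.
have -> : eval_mx (@mono R n) x = (Vandermonde n (\row_a x a))^T.
  by apply/matrixP => a k; rewrite !mxE.
rewrite unitmx_tr unitmxE unitfE det_Vandermonde.
apply/prodf_neq0 => i _; apply/prodf_neq0 => j ij.
by rewrite !mxE subr_eq0; apply: contraTneq ij => /xi ->; rewrite ltnn.
Qed.

(** Points outside [U] are approached within [U] by moving the first coordinate alone, which reduces
    density to one variable. *)
Lemma dense_shift (U : set (R[i] * R[i])) :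
  (forall z : R[i] * R[i],
    ~ U z -> \forall h \near (0 : R[i])^', U (z.1 + h, z.2)) ->
  dense U.
Proof.
move=> Ush O [z Oz] oO; have [Uz|nUz] := pselect (U z); first by exists z.
have Oh : \forall h \near (0 : R[i])^', O (z.1 + h, z.2).
  have z1h : z.1 + h @[h --> (0 : R[i])^'] --> z.1.
    rewrite -[X in _ --> X]addr0.
    by apply: ccvgD; [exact: cvg_cst | exact: cvg_within].
  have z2h : z.2 @[h --> (0 : R[i])^'] --> z.2 by exact: cvg_cst.
  apply: (cvg_pair z1h z2h); case: z Oz {nUz z1h z2h} => z1 z2 Oz.
  exact: (@open_nbhs_nbhs _ (z1, z2) O (conj oO Oz)).
have [h [? ?]] := filter_ex (filterI Oh (Ush z nUz)).
by exists (z.1 + h, z.2).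
Qed.

Lemma open_neq (T : topologicalType) (f : T -> R[i]) (c : R[i]) :
  continuous f -> open [set z | f z != c].
Proof.
move=> cf; rewrite openE => z /= fz.
have : \forall w \near z, f w - c != 0.
  apply: (@ccvg_neq0 _ _ (nbhs z) (nbhs_pfilter z) _ (f z - c)).
    apply: (@ccvgB _ _ (nbhs z) (nbhs_pfilter z)); first exact: cf.
    exact: cvg_cst.
  by rewrite subr_eq0.
by apply: filterS => w; rewrite subr_eq0.
Qed.

Lemma continuous_pole (delta : R[i]) :
  continuous (fun z : R[i] * R[i] => z.1 - z.2 - delta).
Proof.
move=> z; apply: (@ccvgB _ _ (nbhs z) (nbhs_pfilter z)); last exact: cvg_cst.
apply: (@ccvgB _ _ (nbhs z) (nbhs_pfilter z)); first exact: cvg_fst.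
exact: cvg_snd.
Qed.

Lemma dense_pole (delta : R[i]) :
  dense [set z : R[i] * R[i] | z.1 - z.2 - delta != 0].
Proof.
apply: dense_shift => z /= /negP; rewrite negbK => /eqP w0.
have : \forall h \near (0 : R[i])^', h != 0 by exact: nbhs_dnbhs_neq.
apply: filterS => h h0.
have -> : z.1 + h - z.2 - delta = z.1 - z.2 - delta + h by ring.
by rewrite w0 add0r.
Qed.

(** Moving off a pole by $h$ gives the value $e^{ah}$ with $a = 2\pi i/\tau$, and $(e^{ah} - 1)/h
    \to a \ne 0$ keeps it from being $1$. *)
Lemma dense_qexp_pole tau (delta : R[i]) : tau != 0 ->
  dense [set z : R[i] * R[i] | qexp tau (z.1 - z.2 - delta) != 1].
Proof.
move=> t0; apply: dense_shift => z /= /negP; rewrite negbK => /eqP w0.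
have a0 : 2 * ipi / tau != 0 :> R[i] by rewrite mulf_neq0 ?ipi_neq0 ?invr_eq0.
have : \forall h \near (0 : R[i])^', (cexp (2 * ipi / tau * h) - 1) / h != 0.
  apply: (@ccvg_neq0 _ _ _ _ _ (2 * ipi / tau)); last exact: a0.
  exact: cexp_deriv0.
apply: filterS => h; apply: contra_neq => h1.
have : qexp tau (z.1 + h - z.2 - delta) = qexp tau h.
  by rewrite -[RHS]mul1r -w0 -qexpD; congr qexp; ring.
by rewrite h1 /qexp mulrAC => <-; rewrite subrr mul0r.
Qed.

Lemma near_qexp_neq1 z : z != 0 -> \forall tau \near cinfty, qexp tau z != 1.
Proof.
move=> z0; have : \forall tau \near cinfty, qnum tau z != 0.
  by apply: (@ccvg_neq0 _ _ _ _ _ z) => //; exact: qnum_cvg.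
apply: filterS => t; apply: contra_neq; rewrite /qnum => ->.
by rewrite subrr mulr0.
Qed.

Lemma Gth_cvg z w : z != 0 -> w != 0 ->
  Gth (fun z : R[i] => csin (pi%:C * z / tau)) z w @[tau --> cinfty] -->
  Gth (fun z : R[i] => z) z w.
Proof.
move=> z0 w0; rewrite Gth_id.
apply: (@ccvg_near_eq _ _ _ _
  (fun tau => qnum tau (z + w) / (qnum tau z * qnum tau w))).
  by apply: filterS near_cinfty_neq0 => t t0; rewrite Gth_csin.
apply: ccvgM; first exact: qnum_cvg.
apply: ccvgV; first by rewrite mulf_neq0.
by apply: ccvgM; exact: qnum_cvg.
Qed.

(** The points at which the operator evaluates its argument do not depend on [tau], so pointwise
    convergence of kernel and basis suffices. *)
Lemma SUt_cvg n kappa alpha beta lam z1 z2 (i j : 'I_n) :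
  kappa != 0 -> lam != 0 -> z1 - z2 - 2 * (alpha * lam + beta) != 0 ->
  SUt tau kappa alpha beta lam (tens (phit tau i) (phit tau j)) z1 z2
    @[tau --> cinfty] -->
  SUr kappa alpha beta lam (tens (mono i) (mono j)) z1 z2.
Proof.
move=> k0 l0 w0; rewrite /SUt /SUr /SU /tens.
apply: ccvgB; apply: ccvgM.
- exact: Gth_cvg.
- by apply: ccvgM; exact: phit_cvg.
- exact: Gth_cvg.
- by apply: ccvgM; exact: phit_cvg.
Qed.

(* The values of [phit] on a grid converge to an invertible Vandermonde matrix,
   and [Hmx] is a factor of their matrix. *)
Lemma near_Hmx_unit n : \forall tau \near @cinfty R, Hmx n tau \in unitmx.
Proof.
pose x (a : 'I_n) : R[i] := a%:R.
have xi : injective x by move=> a b /eqP; rewrite eqr_nat => /eqP/val_inj.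
have : \forall tau \near cinfty, eval_mx (phit (n := n) tau) x \in unitmx.
  apply: (ccvg_unitmx _ (eval_mx_mono_unit xi)) => a k.
  by under eq_fun do rewrite mxE; rewrite mxE; exact: phit_cvg.
apply: filterS => tau.
have -> : eval_mx (phit (n := n) tau) x = eval_mx (phi tau) x *m Hmx n tau.
  apply/matrixP => a k; rewrite !mxE phit_phi; apply: eq_bigr => l _.
  by rewrite [eval_mx _ _ _ _]mxE mulrC.
by rewrite unitmx_mul => /andP[].
Qed.

Lemma Vt_fspan_phit n tau : Hmx n tau \in unitmx ->
  Vt n tau = fspan (phit (n := n) tau).
Proof.
move=> Hu; apply/seteqP; split=> f [c cE].
- exists (fun k => \sum_l invmx (Hmx n tau) k l * c l) => z; rewrite cE.
  under [RHS]eq_bigr do rewrite phit_phi mulr_sumr.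
  rewrite exchange_big; apply: eq_bigr => a _ /=.
  transitivity
    ((Hmx n tau *m invmx (Hmx n tau) *m \col_l c l) a 0 * phi tau a z).
    by rewrite mulmxV// mul1mx mxE.
  rewrite -mulmxA mxE mulr_suml; apply: eq_bigr => k _.
  have -> : \sum_l invmx (Hmx n tau) k l * c l =
      (invmx (Hmx n tau) *m \col_l c l) k 0.
    by rewrite [RHS]mxE; apply: eq_bigr => l _; rewrite [(\col_l c l) _ _]mxE.
  by ring.
- exists (fun a => \sum_k Hmx n tau a k * c k) => z; rewrite cE.
  under eq_bigr do rewrite phit_phi mulr_sumr.
  rewrite exchange_big; apply: eq_bigr => a _ /=.
  by rewrite mulr_suml; apply: eq_bigr => k _; ring.
Qed.

End shibukawa_ueno.

(** * Degeneration of the operators and of the Cremmer-Gervais matrix *)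

Theorem theorem4p6 (R : realType) (n : nat) (kappa alpha beta lam : R[i])
    (n_gt0 : (0 < n)%N) (kappa_neq0 : kappa != 0) (lam_neq0 : lam != 0) :
  rep_degenerates
    (fun tau => SUt tau kappa alpha beta lam) (Vt n) (phit (n := n))
    (SUr kappa alpha beta lam) (Vr n) (mono (n := n))
  /\
  CG_norm tau kappa lam *:
    (invmx (Hmx n tau *t Hmx n tau)
     *m R_CG n tau kappa alpha (beta - kappa / (2 * n%:R)) lam
     *m (Hmx n tau *t Hmx n tau)) @[tau --> cinfty]
    --> R_JCG n kappa alpha beta lam.
Proof.
pose delta := 2 * (alpha * lam + beta).
pose x (a : 'I_n) : R[i] := a%:R.
(* The grid avoids the poles: [x a - y b - delta = a + b + 1]. *)
pose y (a : 'I_n) : R[i] := - delta - 1 - a%:R.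
have xi : injective x by move=> a b /eqP; rewrite eqr_nat => /eqP/val_inj.
have yi : injective y by move=> a b /addrI/oppr_inj/xi.
apply: (@degeneration R n (fun tau => SUt tau kappa alpha beta lam) _ _ _ _ _
  (fun tau => [set z | qexp tau (z.1 - z.2 - delta) != 1])
  [set z | z.1 - z.2 - delta != 0] _ x y).
- by apply: filterS (near_Hmx_unit n) => tau; exact: Vt_fspan_phit.
- by [].
- by move=> k z; exact: phit_cvg.
- by move=> tau k; exact: continuous_phit.
- by move=> k; exact: continuous_mono.
- exact: eval_mx_mono_unit.
- exact: eval_mx_mono_unit.
- by move=> tau; exact: SU_linear.
- exact: SU_linear.
- apply: filterS near_cinfty_neq0 => tau t0; split; last exact: dense_qexp_pole.
  apply: open_neq => z.
  apply: (@continuous_comp _ _ _ (fun z : R[i] * R[i] => z.1 - z.2 - delta)).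
    exact: continuous_pole.
  exact: continuous_cexp_div.
- by apply: open_neq; exact: continuous_pole.
- exact: dense_pole.
- move=> i j /=; rewrite /x /y.
  have -> : i%:R - (- delta - 1 - j%:R) - delta = (i + j).+1%:R :> R[i].
    by rewrite -natr1 natrD; ring.
  by rewrite pnatr_eq0.
- by move=> z z0; exact: near_qexp_neq1.
- by move=> z z0 i j; exact: SUt_cvg.
(* The normalising factor moves onto the inner matrix, which then represents the operator in the
   basis [phi]. *)
- near=> tau; rewrite scalemxAl scalemxAr.
  apply: represents_on_basis_change.
  + exact: SU_linear.
  + by near: tau; exact: near_Hmx_unit.
  + by move=> k z; exact: phit_phi.
  + apply: represents_phi.
    * by near: tau; exact: near_cinfty_neq0.
    * by near: tau; exact: near_qexp_neq1.
    * by near: tau; exact: near_qexp_neq1.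
Unshelve. all: by end_near. Qed.
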